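(* Let $r\ge2$ and $n\ge1$ be integers, let $\omega=e^{2\pi i/r}$, and let $G=\mathbb{Z}_r\wr\mathrm{S}_n$ be the group of $n\times n$ monomial matrices whose nonzero entries are $r$th roots of unity $\omega^j$, acting on $V=\mathbb{C}^n$ (column vectors) by matrix multiplication. Let $\Lambda(G)$ be the set of $r$-tuples of partitions $\underline\alpha=(\alpha^{(1)},\dots,\alpha^{(r)})$ with $\sum_{i=1}^r|\alpha^{(i)}|=n$. Then for every integer $k\ge0$, $$\dim (V^{\otimes k})^G=\sum_{\underline\alpha\in\Lambda(G)}\frac{\Bigl(\sum_{i=1}^rF(\alpha^{(i)})\,\omega^{i-1}\Bigr)^k}{r^{p(\underline\alpha)}\prod_{j=1}^nj^{p_j(\underline\alpha)}\Bigl(\prod_{i=1}^rp_j(\alpha^{(i)})!\Bigr)}.$$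
   Context: A monomial matrix has exactly one nonzero entry in each row and each column. For a partition $\alpha$, $|\alpha|$ is the sum of its parts and $p_j(\alpha)$ is the number of parts of $\alpha$ equal to $j$ (the empty partition is allowed); $F(\alpha)=p_1(\alpha)$ is the number of parts equal to $1$. For $\underline\alpha=(\alpha^{(1)},\dots,\alpha^{(r)})$, $p_j(\underline\alpha)=\sum_{i=1}^rp_j(\alpha^{(i)})$ and $p(\underline\alpha)=\sum_{j=1}^np_j(\underline\alpha)$. $(V^{\otimes k})^G$ is the space of $G$-invariants in $V^{\otimes k}$. Convention: $0^0=1$. *)

(* Defs.v *)
From HB Require Import structures.
From mathcomp Require Import all_boot all_order all_algebra.
From mathcomp Require Import complex mxtens.
From mathcomp Require Import boolp classical_sets cardinality fsbigop reals.
From mathcomp Require Import trigo.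

Set Implicit Arguments.
Unset Strict Implicit.
Unset Printing Implicit Defensive.

Import Order.TTheory GRing.Theory Num.Theory.
Local Open Scope classical_set_scope.
Local Open Scope ring_scope.

(* e^(2 i pi / r), in the form cos + i sin. *)
Definition omega (R : realType) (r : nat) : R[i] :=
  Complex (cos (2 * pi / r%:R)) (sin (2 * pi / r%:R)).

Definition monomial (K : fieldType) (n : nat) (A : 'M[K]_n) : Prop :=
  (forall i, exists! j, A i j != 0) /\ (forall j, exists! i, A i j != 0).

Definition wreath (R : realType) (r n : nat) : set 'M[R[i]]_n :=
  [set A | monomial A /\
           forall i j, A i j != 0 -> exists m : nat, A i j = omega R r ^+ m].
Arguments wreath : clear implicits.

(* The k-th tensor power of K^n is realized as K^(n^k) by means of the
   Kronecker product: v_1 *t (v_2 *t (... *t v_k)) is the pure tensor of the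
   v_i, and the diagonal action of g is left multiplication by g ^t k. *)
Definition invariant (K : fieldType) (n k : nat) (G : set 'M[K]_n)
    (v : 'cV[K]_(n ^ k)) : Prop :=
  forall g, G g -> g ^t k *m v = v.

Lemma invariants_subproof (K : fieldType) (n k : nat) (G : set 'M[K]_n) :
  exists U : {vspace 'cV[K]_(n ^ k)}, forall v, v \in U <-> invariant G v.
Proof.
pose Q d := `[< exists2 U : {vspace 'cV[K]_(n ^ k)},
  \dim U = d & forall v, v \in U -> invariant G v >].
have Q0 : exists d, Q d.
  exists 0%N; apply/asboolP; exists 0%VS; first exact: dimv0.
  by move=> v; rewrite memv0 => /eqP -> g _; rewrite mulmx0.
have Qle d : Q d -> (d <= \dim {: 'cV[K]_(n ^ k)})%N.
  by move=> /asboolP[U <- _]; rewrite dimvS ?subvf.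
case: (ex_maxnP Q0 Qle) => d /asboolP[U dimU UG] dmax.
exists U => v; split; first exact: UG.
move=> vG; have : Q (\dim (U + <[v]>)).
  apply/asboolP; exists (U + <[v]>)%VS => // w.
  move=> /memv_addP[u uU [x /vlineP[a ->] ->]] g Gg.
  by rewrite mulmxDr -scalemxAr (UG _ uU _ Gg) (vG _ Gg).
move=> /dmax; rewrite -dimU => le_dim.
have /eqP -> : U == (U + <[v]>)%VS by rewrite eqEdim addvSl.
exact: subvP (addvSr _ _) _ (memv_line v).
Qed.

Definition invariants (K : fieldType) (n k : nat) (G : set 'M[K]_n) :
    {vspace 'cV[K]_(n ^ k)} :=
  projT1 (cid (invariants_subproof k G)).

Lemma invariantsP (K : fieldType) (n k : nat) (G : set 'M[K]_n)
    (v : 'cV[K]_(n ^ k)) :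
  v \in invariants k G <-> invariant G v.
Proof. by rewrite /invariants; case: cid. Qed.

Definition is_partition (s : seq nat) : bool := sorted geq s && (0%N \notin s).

Record partition := Partition {parts :> seq nat; _ : is_partition parts}.

HB.instance Definition _ := [isSub for parts].
HB.instance Definition _ := [Countable of partition by <:].

Definition mult (j : nat) (a : partition) : nat := count_mem j a.

Definition ones (a : partition) : nat := mult 1 a.

Definition Lambda (r n : nat) : set (r.-tuple partition) :=
  [set a : r.-tuple partition | (\sum_(i < r) sumn (tnth a i))%N = n].
Arguments Lambda : clear implicits.

(* \sum_(a \in A) F a is 0 by convention when F has infinite support in A;
   by this lemma that convention never applies to sums over Lambda r n. *)
Lemma finite_Lambda (r n : nat) : finite_set (Lambda r n).
Proof.
have sz (s : partition) : (size s <= sumn s)%N.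
  case: s => s /= /andP[_]; elim: s => //= x s IH.
  rewrite in_cons negb_or => /andP[x0 /IH le_s].
  by rewrite -add1n leq_add // lt0n eq_sym.
have le_part (s : partition) x : x \in (s : seq nat) -> (x <= sumn s)%N.
  case: s => s /= _; elim: s => //= y s IH.
  rewrite in_cons => /predU1P[-> | /IH le_x]; first exact: leq_addr.
  exact: leq_trans le_x (leq_addl _ _).
pose code (a : r.-tuple partition) : {ffun 'I_r -> {bseq n of 'I_n.+1}} :=
  [ffun i => insub_bseq n [seq inord x | x <- tnth a i : seq nat]].
have codeK a i : Lambda r n a ->
    [seq val x | x <- code a i] = tnth a i :> seq nat.
  move=> La; have le_n : (sumn (tnth a i) <= n)%N.
    by rewrite -La (bigD1 i) //= leq_addr.
  rewrite ffunE /insub_bseq val_insubd size_map (leq_trans (sz _) le_n).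
  rewrite -map_comp -[RHS]map_id; apply/eq_in_map => x xs /=.
  by rewrite inordK // ltnS (leq_trans (le_part _ _ xs)).
rewrite -(eq_finite_set (@inj_card_eq _ _ (Lambda r n) code _)) => [|a b].
  exact: finite_finset.
move=> /set_mem La /set_mem Lb eq_ab; apply: eq_from_tnth => i.
by apply: val_inj; rewrite /= -codeK // -[RHS]codeK // eq_ab.
Qed.

Definition tmult (r j : nat) (a : r.-tuple partition) : nat :=
  (\sum_(i < r) mult j (tnth a i))%N.

Definition nparts (r n : nat) (a : r.-tuple partition) : nat :=
  (\sum_(1 <= j < n.+1) tmult j a)%N.

(* Main.v *)
Require Import Defs.
From HB Require Import structures.
From mathcomp Require Import all_boot all_order all_algebra all_fingroup.
From mathcomp Require Import complex mxtens.
From mathcomp Require Import boolp classical_sets functions cardinality fsbigop reals.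
From mathcomp Require Import trigo.

Set Implicit Arguments.
Unset Strict Implicit.
Unset Printing Implicit Defensive.

Import Order.TTheory GRing.Theory Num.Theory.
Local Open Scope classical_set_scope.
Local Open Scope ring_scope.

(* Averaging g^{(x)k} over G yields a projection onto the invariants, so the
   dimension is the mean of (tr g)^k over pairs (c, s) of a coloring and a
   permutation, where tr g is the sum of the w^(c i) over the fixed points i
   of s.  The conjugacy classes of G are never counted.  Instead, for an
   arbitrary function f let A f (x) be the mean of the f (x + w^a), and
   D = A - 1.  The mean over c of f (tr g) is (A^fix(s) f)(0), and expanding
   A^m = (1 + D)^m shows that the mean of f (tr g) over G is
   E_n f = sum_(m <= n) (D^m f)(0) / m!.

   On the other side let P_n f be the sum over Lambda of f (trace) / z.
   Weighting by n = sum of the parts and removing one part gives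
     n P_n f = P_(n-1) (A f) + sum_(2 <= j <= n) P_(n-j) f,
   and E_n satisfies the same recursion. *)

(** * Invariants as a group average *)

(** Write [P] as [col_base P *m row_base P]. In [P *m P = P] the outer factors cancel, which leaves
    [row_base P *m col_base P = 1], an identity of size [\rank P]; cyclicity of the trace does the
    rest. *)
Lemma mxtrace_idempotent (K : fieldType) (m : nat) (P : 'M[K]_m) :
  P *m P = P -> \tr P = (\rank P)%:R.
Proof.
move=> PP; rewrite -{1}(mulmx_base P) mxtrace_mulC.
suff -> : row_base P *m col_base P = 1%:M by rewrite mxtrace1.
have inj_l := row_full_inj (col_base_full P).
have inj_r := row_free_inj (row_base_free P).
apply: inj_r; apply: inj_l; rewrite mul1mx mulmx_base -[RHS]PP.
by rewrite -mulmxA mulmx_base mulmxA mulmx_base.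
Qed.

(** The transposed basis vectors of [U] form a row-free matrix [B] with the row space of [P^T]:
    basis vectors are fixed by [P], and columns of [P] are fixed because [P] is idempotent, hence
    lie in [U]. *)
Lemma dim_fixed_idempotent (K : fieldType) (m : nat) (P : 'M[K]_m)
    (U : {vspace 'cV[K]_m}) :
  (forall v, v \in U <-> P *m v = v) -> P *m P = P -> \dim U = \rank P.
Proof.
move=> UP PP; pose B := \matrix_(i < \dim U) ((vbasis U)`_i)^T.
have freeB : row_free B.
  apply: inj_row_free => u; rewrite mulmx_sum_row => uB0.
  have /freeP free_b := basis_free (vbasisP U).
  apply/rowP => i; rewrite mxE; apply: (free_b (fun i => u 0 i)).
  apply: trmx_inj; rewrite trmx0 -[RHS]uB0 linear_sum.
  by apply: eq_bigr => j _; rewrite linearZ rowK.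
rewrite -(eqP freeB) -[\rank P]mxrank_tr; apply/eqP; rewrite eqn_leq.
apply/andP; split; apply: mxrankS; apply/row_subP => i.
  rewrite rowK; have /vbasis_mem/UP <- : (vbasis U)`_i \in vbasis U.
    by rewrite mem_nth // size_tuple.
  by rewrite trmx_mul submxMl.
have : col i P \in U by apply/UP; rewrite colE mulmxA PP.
rewrite -tr_col => /coord_vbasis ->; rewrite linear_sum summx_sub // => j _.
have rowB : row j B = ((vbasis U)`_j)^T by exact: rowK.
by rewrite linearZ /= -rowB scalemx_sub ?row_sub.
Qed.

Lemma ntensmx_mul (K : fieldType) (n k : nat) (A B : 'M[K]_n) :
  (A *m B) ^t k = A ^t k *m B ^t k.
Proof.
case: k => [|k]; first by rewrite !ntensmx0 mul1mx.
by elim: k => [|k IH]; rewrite ?ntensmx1 // !ntensmxSS IH tensmx_mul.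
Qed.

Lemma mxtrace_tens (K : fieldType) (m n : nat) (A : 'M[K]_m) (B : 'M[K]_n) :
  \tr (A *t B) = \tr A * \tr B.
Proof. by rewrite mulr_sum; apply: eq_bigr => i _; rewrite mxE. Qed.

Lemma mxtrace_ntens (K : fieldType) (n k : nat) (A : 'M[K]_n) :
  \tr (A ^t k) = \tr A ^+ k.
Proof.
case: k => [|k]; first by rewrite ntensmx0 mxtrace1 expr0.
elim: k => [|k IH]; first by rewrite ntensmx1 expr1.
by rewrite ntensmxSS mxtrace_tens IH -exprS.
Qed.

(** [T] indexes the elements of [G]. Left translation by [t] permutes [T], so [M t ^t k] absorbs
    into the average [P]. Hence [P] projects onto the invariants, and its trace is their
    dimension. *)
Lemma dim_invariants_average (K : fieldType) (n k : nat) (G : set 'M[K]_n)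
    (T : finType) (M : T -> 'M[K]_n) (h : T -> T -> T) :
  #|T|%:R != 0 :> K -> (forall t, G (M t)) ->
  (forall g, G g -> exists t, g = M t) ->
  (forall t, injective (h t)) -> (forall t u, M t *m M u = M (h t u)) ->
  (\dim (invariants k G))%:R = #|T|%:R^-1 * \sum_t \tr (M t) ^+ k.
Proof.
move=> T0 GM MG h_inj Mh; pose P := #|T|%:R^-1 *: \sum_t M t ^t k.
have MP t : M t ^t k *m P = P.
  rewrite /P -scalemxAr mulmx_sumr [in RHS](reindex_inj (h_inj t)) /=.
  by congr (_ *: _); apply: eq_bigr => u _; rewrite -Mh ntensmx_mul.
have fixP (v : 'cV_(n ^ k)) : v \in invariants k G <-> P *m v = v.
  rewrite invariantsP; split=> [vG | <- g /MG[t ->]].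
    rewrite -scalemxAl mulmx_suml (eq_bigr (fun=> v)) => [|t _].
      by rewrite sumr_const -[v *+ _]scaler_nat scalerA mulVf ?scale1r.
    exact: vG (GM t).
  by rewrite mulmxA MP.
have PP : P *m P = P.
  rewrite {1}/P -scalemxAl mulmx_suml (eq_bigr (fun=> P)) => [|t _] //.
  by rewrite sumr_const -[P *+ _]scaler_nat scalerA mulVf ?scale1r.
rewrite (dim_fixed_idempotent fixP PP) -(mxtrace_idempotent PP) linearZ /=.
by rewrite linear_sum; congr (_ * _); apply: eq_bigr => t _; exact: mxtrace_ntens.
Qed.

(** * The wreath product as colored permutations *)

Lemma omegaX (R : realType) (r m : nat) :
  omega R r ^+ m = Complex (cos (m%:R * (2 * pi / r%:R)))
                           (sin (m%:R * (2 * pi / r%:R))).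
Proof.
elim: m => [|m IH]; first by rewrite expr0 mul0r cos0 sin0.
rewrite exprS IH /omega; set t := 2 * pi / r%:R.
rewrite -[m.+1]add1n natrD mulrDl mul1r cosD sinD.
by rewrite {1}/GRing.mul /=; congr (Complex _ _); rewrite addrC.
Qed.

Lemma omega_unity (R : realType) (r : nat) : (0 < r)%N -> omega R r ^+ r = 1.
Proof.
move=> r0; rewrite omegaX mulrC divfK ?pnatr_eq0 -?lt0n //.
by rewrite mulr_natl cos2pi sin2pi.
Qed.

Lemma omega_neq0 (R : realType) (r : nat) : (0 < r)%N -> omega R r != 0.
Proof.
move=> r0; apply/eqP => w0; have /eqP := omega_unity R r0.
by rewrite w0 expr0n eqn0Ngt r0 eq_sym oner_eq0.
Qed.

Definition colored_perm_mx (K : fieldType) (r n : nat) (w : K)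
    (cs : {ffun 'I_n -> 'I_r} * 'S_n) : 'M[K]_n :=
  \matrix_(i, j) if j == cs.2 i then w ^+ cs.1 i else 0.

(** The law induced by the matrix product: row [i] of [x] leads to row [x.2 i] of [y], where the
    second color is read. Colors add modulo [r.+1]. *)
Definition colored_perm_mul (r n : nat) (x y : {ffun 'I_n -> 'I_r.+1} * 'S_n) :=
  ([ffun i => x.1 i + y.1 (x.2 i)], (x.2 * y.2)%g).

Lemma colored_perm_mul_inj (r n : nat) (x : {ffun 'I_n -> 'I_r.+1} * 'S_n) :
  injective (colored_perm_mul x).
Proof.
move=> [c s] [d t] [/ffunP eq_c /mulgI ->]; congr (_, _); apply/ffunP => i.
by have := eq_c (x.2^-1%g i); rewrite !ffunE /= permKV => /addrI.
Qed.

Lemma mul_colored_perm_mx (K : fieldType) (r n : nat) (w : K)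
    (x y : {ffun 'I_n -> 'I_r.+1} * 'S_n) :
  w ^+ r.+1 = 1 ->
  colored_perm_mx w x *m colored_perm_mx w y =
  colored_perm_mx w (colored_perm_mul x y).
Proof.
move=> w1; apply/matrixP => i j; rewrite !mxE (bigD1 (x.2 i)) //= !mxE eqxx.
rewrite big1 => [|l /negbTE nl]; last by rewrite mxE nl mul0r.
rewrite addr0 permM; case: eqP => _; last by rewrite mulr0.
by rewrite ffunE /= -exprD (expr_mod _ w1).
Qed.

Lemma mxtrace_colored_perm (K : fieldType) (r n : nat) (w : K)
    (x : {ffun 'I_n -> 'I_r} * 'S_n) :
  \tr (colored_perm_mx w x) = \sum_(i | x.2 i == i) w ^+ x.1 i.
Proof. by rewrite [RHS]big_mkcond; apply: eq_bigr => i _; rewrite mxE eq_sym. Qed.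

Lemma wreath_colored_perm (R : realType) (r n : nat)
    (x : {ffun 'I_n -> 'I_r.+1} * 'S_n) :
  wreath R r.+1 n (colored_perm_mx (omega R r.+1) x).
Proof.
have w0 m : omega R r.+1 ^+ m != 0 by rewrite expf_neq0 ?omega_neq0.
split; last first.
  move=> i j; rewrite mxE; case: (_ =P x.2 _) => [_ _|_]; last by rewrite eqxx.
  by exists (x.1 i).
split=> [i|j].
  exists (x.2 i); split; first by rewrite mxE eqxx.
  by move=> j; rewrite mxE; case: (_ =P x.2 _) => [->//|_]; rewrite eqxx.
exists (x.2^-1%g j); split; first by rewrite mxE permKV eqxx.
by move=> i; rewrite mxE; case: (_ =P x.2 _) => [->|_]; rewrite ?permK // eqxx.
Qed.

(** Uniqueness along rows makes the position of the nonzero entry a function [s], uniqueness along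
    columns makes it injective, and exponents are reduced modulo [r.+1]. *)
Lemma wreathP (R : realType) (r n : nat) (g : 'M[R[i]]_n) :
  wreath R r.+1 n g ->
  exists x : {ffun 'I_n -> 'I_r.+1} * 'S_n, g = colored_perm_mx (omega R r.+1) x.
Proof.
move=> [[rowg colg] gw].
have /choice[s sP] : forall i, exists j, g i j != 0 /\
    forall j', g i j' != 0 -> j = j' by move=> i; have [j []] := rowg i; exists j.
have s_inj : injective s.
  move=> i i' eqs; have [l [_ lP]] := colg (s i).
  by rewrite -(lP i (sP i).1) (lP i') // eqs (sP i').1.
have /choice[c cP] : forall i, exists m : 'I_r.+1, g i (s i) = omega R r.+1 ^+ m.
  move=> i; have [m ->] := gw _ _ (sP i).1.
  by exists (inord (m %% r.+1)); rewrite inordK ?ltn_mod // expr_mod ?omega_unity.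
exists (finfun c, perm s_inj); apply/matrixP => i j; rewrite mxE permE ffunE.
case: eqP => [->//|/eqP js]; apply: contra_neq_eq js => /(proj2 (sP i)) //.
Qed.

(** * Averages over the wreath product *)

Definition avg (K : numFieldType) (r : nat) (e : 'I_r.+1 -> K) (f : K -> K) : K -> K :=
  fun x => r.+1%:R^-1 * \sum_a f (x + e a).

Definition davg (K : numFieldType) (r : nat) (e : 'I_r.+1 -> K) (f : K -> K) : K -> K :=
  fun x => avg e f x - f x.

(** The exponential series of the operator [davg e], truncated after degree [n]. *)
Definition exp_davg (K : numFieldType) (r : nat) (e : 'I_r.+1 -> K) (n : nat)
    (f : K -> K) : K -> K :=
  fun x => \sum_(m < n.+1) iter m (davg e) f x / m`!%:R.

Section Averages.
Variables (K : numFieldType) (r : nat) (e : 'I_r.+1 -> K).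

Lemma avg_sum (I : finType) (g : I -> K -> K) (b : I -> K) (x : K) :
  avg e (fun y => \sum_i g i y * b i) x = \sum_i avg e (g i) x * b i.
Proof.
rewrite /avg exchange_big mulr_sumr; apply: eq_bigr => i _ /=.
by rewrite -mulr_suml mulrA.
Qed.

Lemma davg_sum (I : finType) (g : I -> K -> K) (b : I -> K) (x : K) :
  davg e (fun y => \sum_i g i y * b i) x = \sum_i davg e (g i) x * b i.
Proof.
rewrite /davg avg_sum -sumrB.
by apply: eq_bigr => i _; rewrite mulrBl.
Qed.

Lemma davg_shift (m : nat) (f : K -> K) (y x : K) :
  iter m (davg e) (fun z => f (z + y)) x = iter m (davg e) f (x + y).
Proof.
elim: m x => //= m IH x; rewrite {1}/davg IH /avg /davg /avg.
by congr (_ * _ - _); apply: eq_bigr => a _; rewrite IH addrAC.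
Qed.

Lemma exp_davg_shift (n : nat) (f : K -> K) (y : K) :
  exp_davg e n (fun z => f (z + y)) 0 = exp_davg e n f y.
Proof. by apply: eq_bigr => m _; rewrite davg_shift add0r. Qed.

(** Binomial expansion of [(1 + D)^m]. The range is bounded by [N] rather than [m] so that
    permutations with different numbers of fixed points share one index set. *)
Lemma iter_avg (N m : nat) (f : K -> K) : (m <= N)%N ->
  iter m (avg e) f = fun x => \sum_(j < N.+1) iter j (davg e) f x * 'C(m, j)%:R.
Proof.
elim: m => [|m IH] lemN; apply/funext => x.
  rewrite big_ord_recl bin0 mulr1 big1 ?addr0 // => j _.
  by rewrite bin0n mulr0.
rewrite iterS IH ?(ltnW lemN) // avg_sum.
have avgE g y : avg e g y = g y + davg e g y by rewrite addrC subrK.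
under eq_bigr do rewrite avgE mulrDl.
(* The top term of the shifted sum has coefficient ['C(m, N) = 0]; the other terms combine by
   Pascal's rule. *)
rewrite big_split /= [X in X + _]big_ord_recl [X in _ + X]big_ord_recr /=.
rewrite (bin_small lemN) mulr0 addr0 big_ord_recl !bin0 -addrA -big_split /=.
by congr (_ + _); apply: eq_bigr => j _; rewrite binS natrD mulrDr.
Qed.

Lemma sum_colorings (n : nat) (F : {set 'I_n}) (f : K -> K) (x : K) :
  \sum_(c : {ffun 'I_n -> 'I_r.+1}) f (x + \sum_(i in F) e (c i)) =
  r.+1%:R ^+ n * iter #|F| (avg e) f x.
Proof.
move: {2}#|F| (erefl #|F|) => m; elim: m F f => [|m IH] F f cardF.
  rewrite cardF (eq_bigr (fun=> f x)) => [|c _]; last first.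
    by rewrite (cards0_eq cardF) big_set0 addr0.
  by rewrite sumr_const card_ffun !card_ord -natrX mulr_natl.
have /card_gt0P[i0 Fi0] : (0 < #|F|)%N by rewrite cardF.
have cardF' : #|F :\ i0| = m by have := cardsD1 i0 F; rewrite Fi0 cardF => -[].
rewrite cardF iterSr -cardF' -IH //.
have r0 : r.+1%:R != 0 :> K by rewrite pnatr_eq0.
apply: (mulfI r0); rewrite -[in RHS]mulr_sumr mulVKf //.
rewrite mulr_natl -[X in _ *+ X](card_ord r.+1) -sumr_const.
(* The factor [r.+1] became a sum over [a]. Shifting the color of [i0] by [a] permutes the
   colorings, so the color of [i0] gets averaged separately from the others. *)
pose sh a (c : {ffun 'I_n -> 'I_r.+1}) := [ffun i => if i == i0 then c i + a else c i].
have sh_inj a : injective (sh a).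
  move=> c d /ffunP eq_cd; apply/ffunP => i; have := eq_cd i.
  by rewrite !ffunE; case: eqP => // _ /addIr.
under eq_bigr => a _ do rewrite (reindex_inj (sh_inj a)) /=.
rewrite exchange_big; apply: eq_bigr => c _ /=.
rewrite [RHS](reindex_inj (addrI (c i0))) /=; apply: eq_bigr => a _.
rewrite (big_setD1 i0) //= ffunE eqxx [X in x + X]addrC addrA.
congr (f (_ + _ + _)); apply: eq_bigr => i.
by rewrite !finset.inE ffunE => /andP[/negbTE -> _].
Qed.

(** The number of fixed points has binomial moments [1 / j!]. Count pairs of a [j]-set [S] and a
    permutation fixing [S] pointwise: each [S] admits [(n - j)!] permutations, those supported on
    its complement. *)
Lemma sum_bin_fixpoints (n j : nat) : (j <= n)%N ->
  (\sum_(s : 'S_n) 'C(#|[set i | s i == i]%SET|, j) * j`! = n`!)%N.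
Proof.
move=> lejn.
under eq_bigr do rewrite -cards_draws -sum1_card big_distrl /=.
rewrite (exchange_big_dep (fun S : {set 'I_n} => #|S| == j)) /=; last first.
  by move=> s S _; rewrite finset.inE => /andP[].
rewrite (eq_bigr (fun=> (n - j)`! * j`!)%N) => [|S /eqP cardS]; last first.
  rewrite -big_distrl /= sum1_card; congr (_ * _)%N.
  have <- : #|~: S| = (n - j)%N by rewrite cardsCs finset.setCK card_ord cardS.
  rewrite -card_perm; apply: eq_card => s.
  rewrite [LHS](_ : _ = (S \in [set A : {set 'I_n} |
    A \subset [set i | s i == i]%SET & #|A| == j]%SET)) //.
  rewrite [RHS]unfold_in finset.inE cardS eqxx andbT.
  apply/fintype.subsetP/fintype.subsetP => sub i.
    by rewrite !finset.inE; apply: contra => /sub; rewrite finset.inE.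
  by move=> Si; rewrite finset.inE; apply: contraT => /sub; rewrite finset.inE Si.
rewrite sum_nat_const -[in RHS](bin_fact lejn) [(_`! * _`!)%N]mulnC.
congr (_ * _)%N; have := card_draws 'I_n j; rewrite card_ord => <-.
by apply: eq_card => S; rewrite finset.inE.
Qed.

Lemma sum_perm_avg (n : nat) (f : K -> K) (x : K) :
  \sum_(s : 'S_n) iter #|[set i | s i == i]%SET| (avg e) f x =
  n`!%:R * exp_davg e n f x.
Proof.
have le_fix (s : 'S_n) : (#|[set i | s i == i]%SET| <= n)%N.
  by have := max_card [set i | s i == i]%SET; rewrite card_ord.
under eq_bigr => s _ do rewrite (iter_avg f (le_fix s)).
rewrite exchange_big mulr_sumr; apply: eq_bigr => j _ /=.
rewrite -mulr_sumr mulrCA; congr (_ * _).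
have j0 : j`!%:R != 0 :> K by rewrite pnatr_eq0 -lt0n fact_gt0.
apply: (mulIf j0); rewrite divfK //.
rewrite -natr_sum -natrM big_distrl /=; congr _%:R.
by apply: sum_bin_fixpoints; rewrite -ltnS ltn_ord.
Qed.

(** The term [d m / m!] occurs [m] times in the first sum and, once for each [j] from [m] to
    [n - 1], another [n - m] times in the second. *)
Lemma sum_exp (d : nat -> K) (n : nat) :
  \sum_(i < n) d i.+1 / i`!%:R + \sum_(j < n) \sum_(m < j.+1) d m / m`!%:R =
  n%:R * \sum_(m < n.+1) d m / m`!%:R.
Proof.
elim: n => [|n IH]; first by rewrite !big_ord0 mul0r addr0.
rewrite big_ord_recr /= [X in _ + X]big_ord_recr /= addrACA {}IH.
rewrite [in RHS]big_ord_recr /=; set S := \sum_(m < n.+1) _.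
rewrite addrCA addrC -{2}[S]mul1r -mulrDl natr1 mulrDr; congr (_ + _).
by rewrite factS natrM invfM mulrCA mulVKf // pnatr_eq0.
Qed.

(** In [sum_exp] at [n.+1], the first sum is [D] applied to [exp_davg e n f]. Adding the term
    [j = n] of the second sum turns [D] into [1 + D], the average. *)
Lemma exp_davg_rec (n : nat) (f : K -> K) :
  n.+1%:R * exp_davg e n.+1 f 0 =
  r.+1%:R^-1 * (\sum_a exp_davg e n f (e a)) + \sum_(j < n) exp_davg e j f 0.
Proof.
rewrite -(sum_exp (fun m => iter m (davg e) f 0)).
rewrite [X in _ + X]big_ord_recr /= addrCA addrC.
congr (_ + _); transitivity (avg e (exp_davg e n f) 0); last first.
  by rewrite /avg; congr (_ * _); apply: eq_bigr => a _; rewrite add0r.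
rewrite -[avg _ _ _](subrK (exp_davg e n f 0)); congr (_ + _).
exact/esym/davg_sum.
Qed.

End Averages.

(** * Sums over multipartitions, by multiplicities *)

Section Multiplicities.
Variables (K : numFieldType) (I : finType) (N : nat).
Variables (w : I -> nat) (c e : I -> K).
Hypothesis w_gt0 : forall p, (0 < w p)%N.
Implicit Types (mu : {ffun I -> 'I_N.+1}) (f : K -> K).

(* [mu p] is the multiplicity of a part [p] of size [w p]; the bound [N] on
   multiplicities is harmless for [n <= N]. *)
Definition mult_sum n f : K :=
  \sum_(mu : {ffun I -> 'I_N.+1} | (\sum_p w p * mu p)%N == n)
    f (\sum_p e p *+ mu p) / \prod_p (c p ^+ mu p * (mu p)`!%:R).

Lemma mult_sum0 f : mult_sum 0 f = f 0.
Proof.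
rewrite /mult_sum (big_pred1 [ffun=> ord0]) => [|mu].
  by rewrite !big1 ?divr1 // => p _; rewrite ffunE // expr0 fact0 mulr1.
rewrite sum_nat_eq0; apply/forallP/eqP => [mu0|-> p]; last by rewrite ffunE muln0.
apply/ffunP => p; apply/val_inj/eqP; rewrite ffunE /=.
by have := mu0 p; rewrite /= muln_eq0 eqn0Ngt w_gt0.
Qed.

(* The bijection deletes one copy of [p]: [mu p / mu p`! = 1 / (mu p - 1)`!]. *)
Lemma mult_sum_remove n f p : (n <= N)%N ->
  \sum_(mu : {ffun I -> 'I_N.+1} | (\sum_q w q * mu q)%N == n)
    (mu p)%:R * (f (\sum_q e q *+ mu q) /
                 \prod_q (c q ^+ mu q * (mu q)`!%:R)) =
  if (w p <= n)%N then (c p)^-1 * mult_sum (n - w p)%N (fun x => f (x + e p)) else 0.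
Proof.
move=> lenN.
pose up (nu : {ffun I -> 'I_N.+1}) : {ffun I -> 'I_N.+1} :=
  [ffun q => if q == p then inord (nu q).+1 else nu q].
pose down (mu : {ffun I -> 'I_N.+1}) : {ffun I -> 'I_N.+1} :=
  [ffun q => if q == p then inord (mu q).-1 else mu q].
have leN (mu : {ffun I -> 'I_N.+1}) m : (\sum_q w q * mu q <= m)%N -> (w p * mu p <= m)%N.
  by apply: leq_trans; rewrite (bigD1 p) //= leq_addr.
have upE (nu : {ffun I -> 'I_N.+1}) : (nu p < N)%N ->
    up nu p = (nu p).+1 :> nat by move=> lt; rewrite ffunE eqxx inordK.
have upN (nu : {ffun I -> 'I_N.+1}) q : q != p -> up nu q = nu q.
  by move=> /negbTE qp; rewrite ffunE qp.
have sum_up (nu : {ffun I -> 'I_N.+1}) : (nu p < N)%N ->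
    (\sum_q w q * up nu q = w p + \sum_q w q * nu q)%N.
  move=> ltp; rewrite (bigD1 p) // [in RHS](bigD1 p) //= upE // mulnS addnA.
  by congr (_ + _)%N; apply: eq_bigr => q qp; rewrite upN.
rewrite (bigID (fun mu : {ffun I -> 'I_N.+1} => (0 < mu p)%N)) /=.
rewrite [X in _ + X]big1 ?addr0 => [|mu /andP[_]]; last first.
  by rewrite -eqn0Ngt => /eqP ->; rewrite mul0r.
rewrite (reindex_onto up down) => [|mu /andP[/eqP sum_mu mu_gt0]]; last first.
  apply/ffunP => q; rewrite !ffunE; case: eqP => // ->; apply/val_inj.
  by rewrite /= !inordK ?prednK // ltnW // ltnS prednK.
have condE (nu : {ffun I -> 'I_N.+1}) :
   ((\sum_q w q * up nu q)%N == n) && (0 < up nu p)%N && (down (up nu) == nu) =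
   (w p <= n)%N && ((\sum_q w q * nu q)%N == n - w p)%N.
  have [ltp|] := ltnP (nu p) N.
    rewrite sum_up // upE //= andbT.
    have -> : down (up nu) == nu.
      apply/eqP/ffunP => q; rewrite !ffunE; case: eqP => // ->.
      by apply/val_inj; rewrite /= !inordK // ltnW.
    rewrite andbT; apply/eqP/andP => [<-|[le /eqP ->]]; last exact: subnKC.
    by rewrite leq_addr addKn.
  rewrite leqNgt -ltnNge ltnS => leNp.
  have nupN : nu p = N :> nat by apply/eqP; rewrite eqn_leq leNp -ltnS ltn_ord.
  (* At multiplicity [N] the successor overflows and [inord] returns 0, so the left condition fails.
     The right one fails too: [N] copies of [p] weigh at least [n], more than [n - w p]. *)
  have up0 : up nu p = 0%N :> nat.
    by rewrite ffunE eqxx /inord nupN val_insubd ltnn.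
  rewrite up0 andbF; symmetry; apply/negbTE/negP => /andP[le /eqP /eq_leq /leN].
  rewrite nupN leqNgt => /negP; apply; apply: (@leq_trans n).
    by rewrite ltn_subLR // -{1}[n]add0n ltn_add2r.
  exact: leq_trans lenN (leq_pmull _ (w_gt0 p)).
rewrite (eq_bigl _ _ condE); case: ifP => lewn /=; last by rewrite big_pred0.
rewrite mulr_sumr; apply: eq_bigr => nu /eqP sum_nu.
have ltp : (nu p < N)%N.
  have /leN le : (\sum_q w q * nu q <= n - w p)%N by rewrite sum_nu.
  apply: leq_trans lenN; apply: leq_ltn_trans (leq_trans (leq_pmull _ (w_gt0 p)) le) _.
  by rewrite ltn_subLR // -{1}[n]add0n ltn_add2r.
have -> : \sum_q e q *+ up nu q = \sum_q e q *+ nu q + e p.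
  rewrite (bigD1 p) // [in RHS](bigD1 p) //= upE // mulrSr addrAC.
  by congr (_ + _ + _); apply: eq_bigr => q qp; rewrite upN.
have -> : \prod_q (c q ^+ up nu q * (up nu q)`!%:R) =
    c p * (nu p).+1%:R * \prod_q (c q ^+ nu q * (nu q)`!%:R).
  rewrite (bigD1 p) // [in RHS](bigD1 p) //= upE // exprS factS natrM mulrACA.
  by rewrite -[LHS]mulrA; congr (_ * (_ * _)); apply: eq_bigr => q qp; rewrite upN.
have s0 : (nu p).+1%:R != 0 :> K by rewrite pnatr_eq0.
rewrite upE // !invfM mulrCA [RHS]mulrCA; congr (_ * _).
by rewrite mulrA; congr (_ * _); rewrite mulrC divfK.
Qed.

(** The factor [n] is replaced, inside the sum, by the total weight of [mu]; each part [p] is then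
    removed in turn. *)
Lemma mult_sum_rec n f : (n <= N)%N ->
  n%:R * mult_sum n f =
  \sum_(p | (w p <= n)%N)
    (w p)%:R / c p * mult_sum (n - w p)%N (fun x => f (x + e p)).
Proof.
move=> lenN; rewrite [RHS]big_mkcond.
transitivity (\sum_p (w p)%:R *
  (\sum_(mu : {ffun I -> 'I_N.+1} | (\sum_q w q * mu q)%N == n)
    (mu p)%:R * (f (\sum_q e q *+ mu q) /
                 \prod_q (c q ^+ mu q * (mu q)`!%:R)))).
  rewrite /mult_sum mulr_sumr; under [RHS]eq_bigr do rewrite mulr_sumr.
  rewrite exchange_big; apply: eq_bigr => mu /eqP <- /=.
  rewrite natr_sum mulr_suml; apply: eq_bigr => p _.
  by rewrite natrM -mulrA.
by apply: eq_bigr => p _; rewrite mult_sum_remove //; case: ifP; rewrite ?mulr0 // mulrA.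
Qed.

End Multiplicities.

(** The index [(i, j)] stands for a part of size [j.+1] in component [i]. Every coefficient
    [w p / c p] is [1 / r.+1], so both sides satisfy the same recursion in [n]. *)
Lemma mult_sum_exp_davg (K : numFieldType) (r N : nat) (e : 'I_r.+1 -> K)
    (n : nat) (f : K -> K) : (n <= N)%N ->
  mult_sum N (fun p : 'I_r.+1 * 'I_N => p.2.+1)
    (fun p => r.+1%:R * p.2.+1%:R)
    (fun p => if p.2 == 0 :> nat then e p.1 else 0) n f = exp_davg e n f 0.
Proof.
have n0 m : m.+1%:R != 0 :> K by rewrite pnatr_eq0.
elim/ltn_ind: n f => -[|n] IH f lenN.
  by rewrite mult_sum0 // /exp_davg big_ord1 fact0 divr1.
apply: (mulfI (n0 n)); rewrite exp_davg_rec mult_sum_rec //.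
rewrite (eq_bigr (fun p : 'I_r.+1 * 'I_N => r.+1%:R^-1 *
    exp_davg e (n - p.2) f (if p.2 == 0 :> nat then e p.1 else 0))); last first.
  move=> [i j] /= lejn.
  rewrite subSS IH ?ltnS ?leq_subr ?(leq_trans (leq_subr _ _) (ltnW lenN)) //.
  by rewrite exp_davg_shift invfM mulrCA divff // mulr1.
rewrite -mulr_sumr -(pair_big xpredT (fun j : 'I_N => j < n.+1)%N (fun i (j : 'I_N) =>
  exp_davg e (n - j) f (if j == 0 :> nat then e i else 0))) /=.
rewrite exchange_big /=; case: N lenN IH => // N lenN _.
(* Parts of size 1 shift the argument and give the average. For each larger size the [r.+1]
   components contribute equally and cancel the factor [1 / r.+1]. *)
rewrite big_mkcond big_ord_recl /= subn0 mulrDr; congr (_ + _).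
transitivity (\sum_(j < N | (j < n)%N) exp_davg e (n - j.+1) f 0).
  rewrite [RHS]big_mkcond mulr_sumr; apply: eq_bigr => j _ /=.
  rewrite ltnS; case: ifP => _; last by rewrite mulr0.
  by rewrite sumr_const card_ord -(mulr_natl (exp_davg _ _ _ _)) mulKf.
rewrite -(big_ord_widen N (fun j => exp_davg e (n - j.+1) f 0)) //.
by rewrite [RHS](reindex_inj rev_ord_inj).
Qed.

(** * Partitions and their multiplicities *)

Lemma sumn_count (n : nat) (s : seq nat) :
  all (fun x => 0 < x <= n)%N s ->
  sumn s = (\sum_(j < n) j.+1 * count_mem j.+1 s)%N.
Proof.
elim: s => [_|[|x] s IH] //=; first by rewrite big1 // => j _; rewrite muln0.
move=> /andP[xn /IH ->]; under [RHS]eq_bigr do rewrite mulnDr.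
rewrite [RHS]big_split /=; congr (_ + _)%N; rewrite (bigD1 (Ordinal xn)) //= eqxx.
rewrite muln1 big1 ?addn0 // => j; rewrite -val_eqE eqSS eq_sym => /negbTE /= ->.
by rewrite muln0.
Qed.

Definition mult_seq (n : nat) (m : 'I_n -> nat) : seq nat :=
  flatten [seq nseq (m j) j.+1 | j <- enum 'I_n].

Lemma mult_seq_bounds (n : nat) (m : 'I_n -> nat) :
  all (fun x => 0 < x <= n)%N (mult_seq m).
Proof.
apply/allP => x /flatten_mapP[j _ /nseqP[-> _]].
by rewrite /= ltn_ord.
Qed.

Lemma count_mult_seq (n : nat) (m : 'I_n -> nat) (j : 'I_n) :
  count_mem j.+1 (mult_seq m) = m j.
Proof.
rewrite count_flatten sumnE 2!big_map big_enum (bigD1 j) //= count_nseq /= eqxx mul1n.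
rewrite big1 ?addn0 // => i /negbTE ij.
by rewrite count_nseq /= eqSS (inj_eq val_inj) ij.
Qed.

Lemma mult_partition_subproof (n : nat) (m : 'I_n -> nat) :
  is_partition (sort geq (mult_seq m)).
Proof.
rewrite /is_partition sort_sorted => [|x y]; last exact: leq_total.
rewrite mem_sort /=; apply/negP => /(allP (mult_seq_bounds m)).
by rewrite ltnn.
Qed.

Definition mult_partition (n : nat) (m : 'I_n -> nat) : Defs.partition :=
  Partition (mult_partition_subproof m).

Lemma mult_mult_partition (n : nat) (m : 'I_n -> nat) (j : 'I_n) :
  mult j.+1 (mult_partition m) = m j.
Proof. by rewrite /mult /= (seq.permP (permEl (perm_sort _ _))) count_mult_seq. Qed.

Lemma sumn_mult_partition (n : nat) (m : 'I_n -> nat) :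
  sumn (mult_partition m) = (\sum_(j < n) j.+1 * m j)%N.
Proof.
rewrite /= (perm_sumn (permEl (perm_sort _ _))) (sumn_count (mult_seq_bounds m)).
by apply: eq_bigr => j _; rewrite count_mult_seq.
Qed.

Lemma partition_bounds (a : Defs.partition) :
  all (fun x => 0 < x <= sumn a)%N a.
Proof.
case: a => s /= /andP[_ s0]; apply/allP => x xs.
have -> : (0 < x)%N by rewrite lt0n; apply: contraNneq s0 => <-.
by have /perm_sumn -> /= := perm_to_rem xs; rewrite leq_addr.
Qed.

Lemma partition_bounds_leq (n : nat) (a : Defs.partition) :
  (sumn a <= n)%N -> all (fun x => 0 < x <= n)%N a.
Proof.
move=> le; apply: sub_all (partition_bounds a) => x /andP[-> lex].
exact: leq_trans lex le.
Qed.

Lemma partition_eq (n : nat) (a b : Defs.partition) :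
  all (fun x => 0 < x <= n)%N a -> all (fun x => 0 < x <= n)%N b ->
  (forall j : 'I_n, mult j.+1 a = mult j.+1 b) -> a = b.
Proof.
move=> an bn ab; apply: val_inj.
have sorted_partition (c : Defs.partition) : sorted geq c by case: c => c /= /andP[].
apply: (sorted_eq _ _ (sorted_partition a) (sorted_partition b)) => [y x z xy yz||].
- exact: leq_trans yz xy.
- by move=> x y /andP[xy yx]; apply/eqP; rewrite eqn_leq; apply/andP.
(* Sorted lists that are permutations of each other agree, and [perm_eq] only compares counts of
   entries occurring in one of the lists, all between 1 and [n]. *)
apply/allP => x; rewrite mem_cat => xab.
have /andP[x0 xn] : (0 < x <= n)%N.
  by case/orP: xab => [/(allP an)|/(allP bn)].
case: x x0 xn {xab} => // x _ xn.
by have /= /eqP := ab (Ordinal xn).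
Qed.

Section Bridge.
Variables (r n : nat).
Implicit Types (mu : {ffun 'I_r * 'I_n -> 'I_n.+1}).

Definition mult_tuple (mu : {ffun 'I_r * 'I_n -> 'I_n.+1}) : r.-tuple Defs.partition :=
  [tuple mult_partition (fun j => mu (i, j)) | i < r].

Lemma tnth_mult_tuple mu i :
  tnth (mult_tuple mu) i = mult_partition (fun j => mu (i, j) : nat).
Proof. by rewrite tnth_mktuple. Qed.

Lemma mult_tuple_bij :
  set_bij [set mu : {ffun 'I_r * 'I_n -> 'I_n.+1} |
      (\sum_(p : 'I_r * 'I_n) p.2.+1 * mu p)%N == n]
    (Lambda r n) mult_tuple.
Proof.
have sumE mu : (\sum_(i < r) sumn (tnth (mult_tuple mu) i) =
    \sum_(p : 'I_r * 'I_n) p.2.+1 * mu p)%N.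
  under eq_bigr do rewrite tnth_mult_tuple sumn_mult_partition.
  by rewrite pair_bigA; apply: eq_bigr => -[].
split=> [mu /= /eqP mun|mu nu _ _ eq_mn|a La].
- by rewrite /Lambda /= sumE.
- apply/ffunP => -[i j]; apply: val_inj => /=.
  have := congr1 (fun a => mult j.+1 (tnth a i)) eq_mn.
  by rewrite !tnth_mult_tuple !mult_mult_partition.
have le_n i : (sumn (tnth a i) <= n)%N by rewrite -[leqRHS]La (bigD1 i) //= leq_addr.
pose mu : {ffun 'I_r * 'I_n -> 'I_n.+1} :=
  [ffun p : 'I_r * 'I_n => inord (mult p.2.+1 (tnth a p.1))].
(* No truncation by [inord]: a multiplicity is at most the sum of the parts, hence at most [n]. *)
have muE i j : mu (i, j) = mult j.+1 (tnth a i) :> nat.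
  rewrite ffunE inordK // ltnS; apply: leq_trans (le_n i).
  rewrite (sumn_count (partition_bounds_leq (le_n i))) (bigD1 j) //=.
  by rewrite mulSn -addnA leq_addr.
have mua : mult_tuple mu = a.
  apply: eq_from_tnth => i; rewrite tnth_mult_tuple.
  apply: (@partition_eq n) => [||j]; last by rewrite mult_mult_partition.
    by rewrite /= all_sort mult_seq_bounds.
  exact: partition_bounds_leq.
by exists mu => //=; rewrite -sumE mua; apply/eqP.
Qed.

Lemma trace_mult_tuple (K : numFieldType) (e : 'I_r -> K) mu : (0 < n)%N ->
  \sum_(p : 'I_r * 'I_n) (if p.2 == 0 :> nat then e p.1 else 0) *+ mu p =
  \sum_(i < r) (ones (tnth (mult_tuple mu) i))%:R * e i.
Proof.
move=> n_gt0; pose F (i : 'I_r) (j : 'I_n) :=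
  (if j == 0 :> nat then e i else 0) *+ mu (i, j).
rewrite (eq_bigr (fun p => F p.1 p.2)) => [|[i j] _ //].
rewrite -(pair_bigA _ F); apply: eq_bigr => i _ /=.
(* Index 0 encodes the parts of size 1; it exists because [n] is positive. *)
rewrite (bigD1 (Ordinal n_gt0)) //= big1 => [|j]; last first.
  by rewrite -val_eqE /F /= => /negbTE ->; rewrite mul0rn.
rewrite addr0 /F /= tnth_mult_tuple mulr_natl; congr (_ *+ _).
by rewrite /ones (mult_mult_partition _ (Ordinal n_gt0)).
Qed.

(** For [q = r] this is the order of the centralizer of an element of the wreath product with this
    cycle type: each cycle of length [j] contributes [r * j], and equal cycles can be permuted. *)
Lemma centralizer_mult_tuple (K : numFieldType) (q : K) mu :
  q ^+ nparts n (mult_tuple mu) *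
  \prod_(1 <= j < n.+1)
    (j%:R ^+ tmult j (mult_tuple mu) *
     \prod_(i < r) ((mult j (tnth (mult_tuple mu) i))`!)%:R) =
  \prod_(p : 'I_r * 'I_n) ((q * p.2.+1%:R) ^+ mu p * (mu p)`!%:R).
Proof.
pose F (i : 'I_r) (j : 'I_n) := (q * j.+1%:R) ^+ mu (i, j) * (mu (i, j))`!%:R.
rewrite [RHS](eq_bigr (fun p => F p.1 p.2)) => [|[i j] _ //].
rewrite -(pair_bigA _ F) exchange_big /nparts !big_add1 !big_mkord expr_sum.
rewrite -big_split; apply: eq_bigr => j _ /=.
rewrite mulrA -exprMn /tmult expr_sum -big_split; apply: eq_bigr => i _ /=.
by rewrite tnth_mult_tuple mult_mult_partition.
Qed.

End Bridge.

Theorem mainTheorem9 (R : realType) (r n k : nat)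
    (hr : (2 <= r)%N) (hn : (1 <= n)%N) :
  (\dim (invariants k (wreath R r n)))%:R =
  \sum_(a \in Lambda r n)
    (\sum_(i < r) (ones (tnth a i))%:R * omega R r ^+ i) ^+ k /
    (r%:R ^+ nparts n a *
     \prod_(1 <= j < n.+1)
       (j%:R ^+ tmult j a * \prod_(i < r) ((mult j (tnth a i))`!)%:R))
  :> R[i].
Proof.
case: r hr => [//|r] _; set w := omega R r.+1.
have w1 : w ^+ r.+1 = 1 by exact: omega_unity.
pose e (a : 'I_r.+1) : R[i] := w ^+ a.
have cardT : #|{: {ffun 'I_n -> 'I_r.+1} * 'S_n}|%:R = r.+1%:R ^+ n * n`!%:R :> R[i].
  by rewrite card_prod card_ffun card_Sn !card_ord natrM natrX.
have card_neq0 : #|{: {ffun 'I_n -> 'I_r.+1} * 'S_n}|%:R != 0 :> R[i].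
  by rewrite cardT mulf_neq0 ?expf_neq0 ?pnatr_eq0 // -lt0n fact_gt0.
rewrite (@dim_invariants_average _ _ _ _ _ (colored_perm_mx w)
  (@colored_perm_mul r n)) => [|||||]; first last.
- by move=> x y; exact: mul_colored_perm_mx.
- exact: colored_perm_mul_inj.
- by move=> g /wreathP.
- exact: wreath_colored_perm.
- exact: card_neq0.
under eq_bigr do rewrite mxtrace_colored_perm.
(* The group average and the sum over multipartitions meet at this value. For the former, colorings
   are summed first, with the permutation fixed. *)
transitivity (exp_davg e n (fun x => x ^+ k) 0).
  rewrite -(pair_big xpredT xpredT (fun (c : {ffun 'I_n -> 'I_r.+1}) (s : 'S_n) =>
    (\sum_(i | s i == i) w ^+ c i) ^+ k)) /= exchange_big /=.
  rewrite (eq_bigr (fun s : 'S_n => r.+1%:R ^+ n *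
    iter #|[set i | s i == i]%SET| (avg e) (fun x => x ^+ k) 0)) => [|s _].
  rewrite -mulr_sumr sum_perm_avg mulrA -cardT mulKf //.
  rewrite -(sum_colorings e [set i | s i == i]%SET (fun x => x ^+ k)).
  apply: eq_bigr => c _; rewrite add0r; congr (_ ^+ k).
  by apply: eq_bigl => i; rewrite finset.inE.
rewrite -(mult_sum_exp_davg e _ (leqnn n)).
(* Here [N = n], so multiplicity functions correspond exactly to [Lambda r.+1 n]. *)
rewrite (reindex_fsbig _ _ _ _ (@mult_tuple_bij r.+1 n)).
rewrite /mult_sum [LHS]bigfs ?index_enum_uniq //; last first.
  by move=> mu _; rewrite mem_index_enum.
apply: eq_fsbigr => mu _; rewrite centralizer_mult_tuple.
by rewrite (trace_mult_tuple e).
Qed.
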